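(* For all $t,\delta,\lambda,\kappa\in\mathbb{N}$ there are constants $f=f(t,\delta,\lambda,\kappa)\in\mathbb{N}$ and $g=g(t,\kappa)\in\mathbb{N}$ with the following property. Let $G$ be a $t$-tidy graph and let $(A,\mathcal L,Y)$ be an $f$-seedling in $G$ which is $\kappa$-rigid. Then there are $\delta$ pairwise disjoint $\lambda$-seedlings $(A_1,\mathcal L_1,Y_1),\dots,(A_\delta,\mathcal L_\delta,Y_\delta)$ in $G\setminus A$ such that: (a) the paths $A_1,\dots,A_\delta$ are pairwise anticomplete in $G$; (b) for every $i\in\{1,\dots,\delta\}$: $A$ and $A_i$ are not anticomplete in $G$; $A$ and $V(\mathcal L_i)$ are anticomplete in $G$; and $(A_i,\mathcal L_i,Y_i)$ is $g$-rigid.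
   Context: Graphs are finite and simple; $\mathbb{N}$ denotes the positive integers. $G$ is $t$-tidy if $G$ has no subgraph isomorphic to $K_{t+1}$ and no induced minor isomorphic to $K_{t,t}$ (an induced minor is obtained from an induced subgraph by contracting edges and removing loops/parallel edges). A path in $G$ is an induced subgraph that is a path. For $X\subseteq V(G)$, $N_G(X)$ is the set of vertices outside $X$ with a neighbor in $X$. Two vertex sets are anticomplete if they are disjoint and no edge joins them. For $X,Y\subseteq V(G)$, an $(X,Y)$-path in $G$ is a path $P$ with one end in $X$ and one end in $Y$ that is inclusion-minimal with this property (either a single vertex of $X\cap Y$, or one end in $X\setminus Y$, the other in $Y\setminus X$, and interior disjoint from $X\cup Y$). A $\lambda$-seedling in a graph $H$ is a triple $(A,\mathcal L,Y)$ where $A$ is a path in $H$, $Y\subseteq V(H)\setminus A$, and $\mathcal L$ is a set of $\lambda$ pairwise disjoint $(N_H(A),Y)$-paths in $H\setminus A$; $V(\mathcal L)$ denotes the union of their vertex sets. Two seedlings $(A,\mathcal L,Y)$, $(A',\mathcal L',Y')$ are disjoint if $(A\cup V(\mathcal L))\cap(A'\cup V(\mathcal L'))=\varnothing$. A seedling $(A,\mathcal L,Y)$ in $G$ is $\kappa$-rigid if there is no set $\mathcal K$ of $\kappa$ pairwise anticomplete $(N_G(A),Y)$-paths in $G$ with $V(\mathcal K)\subseteq V(\mathcal L)$. *)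

(* Defs.v *)
From mathcomp Require Import all_boot.

Set Implicit Arguments.
Unset Strict Implicit.
Unset Printing Implicit Defensive.

Record sgraph := SGraph {
  vertex :> finType;
  edge : rel vertex;
  edge_sym : symmetric edge;
  edge_irrefl : irreflexive edge }.

Notation "x -- y" := (edge x y) (at level 30).

Lemma neq_op_sym (T : eqType) : symmetric (fun x y : T => x != y).
Proof. by move=> x y; rewrite eq_sym. Qed.

Lemma neq_op_irrefl (T : eqType) : irreflexive (fun x y : T => x != y).
Proof. by move=> x; rewrite eqxx. Qed.

Definition complete_graph (n : nat) : sgraph :=
  SGraph (@neq_op_sym 'I_n) (@neq_op_irrefl 'I_n).

Definition bip_rel (S T : Type) : rel (S + T) :=
  fun u v => match u, v with
             | inl _, inr _ | inr _, inl _ => true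
             | _, _ => false
             end.

Lemma bip_sym (S T : Type) : symmetric (@bip_rel S T).
Proof. by move=> [x|x] [y|y]. Qed.

Lemma bip_irrefl (S T : Type) : irreflexive (@bip_rel S T).
Proof. by move=> [x|x]. Qed.

Definition complete_bipartite (m n : nat) : sgraph :=
  SGraph (@bip_sym 'I_m 'I_n) (@bip_irrefl 'I_m 'I_n).

(* "G has a subgraph, not necessarily induced, isomorphic to H" *)
Definition has_subgraph (G H : sgraph) : Prop :=
  exists f : H -> G, injective f /\ forall u v : H, u -- v -> f u -- f v.

(* H is isomorphic to the simple graph obtained from G[S] by contracting the
   edges of F: the vertices of H are, through phi, the connected components of
   the spanning subgraph (S, F) of G[S]; loops and multiplicities are dropped. *)
Definition has_induced_minor (G H : sgraph) : Prop :=
  exists (S : {set G}) (F : rel G) (phi : G -> H),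
  [/\ symmetric F,
      forall x y, F x y -> [/\ x \in S, y \in S & x -- y],
      forall u : H, exists2 x, x \in S & phi x = u,
      forall x y, x \in S -> y \in S -> (phi x = phi y <-> connect F x y)
    & forall u v : H, u -- v <->
        u <> v /\ exists x y,
          [/\ x \in S, y \in S, phi x = u, phi y = v & x -- y]].

Definition tidy (t : nat) (G : sgraph) : Prop :=
  ~ has_subgraph G (complete_graph t.+1) /\
  ~ has_induced_minor G (complete_bipartite t t).

(* Induced subgraphs of G, in particular paths, are represented by their vertex
   sets.  An argument H : {set G} below stands for the induced subgraph G[H],
   so H = [set: G] is G itself and H = ~: A is G \ A. *)

Section Seedlings.

Variable G : sgraph.
Implicit Types (A H P Q X Y : {set G}) (L K : {set {set G}}).

Definition neighborhood H X : {set G} :=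
  [set v in H :\: X | [exists u in X, u -- v]].

Definition anticomplete X Y : Prop :=
  [disjoint X & Y] /\ forall x y, x \in X -> y \in Y -> ~~ (x -- y).

Definition induced_path_seq (x : G) (p : seq G) : Prop :=
  uniq (x :: p) /\
  forall i j, i < size (x :: p) -> j < size (x :: p) ->
    nth x (x :: p) i -- nth x (x :: p) j = (i.+1 == j) || (j.+1 == i).

(* P is a path with ends x and y; x = y when P has a single vertex. *)
Definition path_with_ends P (x y : G) : Prop :=
  exists p : seq G,
    [/\ induced_path_seq x p, last x p = y & P = [set z in x :: p]].

Definition path_in H P : Prop :=
  P \subset H /\ exists x y, path_with_ends P x y.

Definition joins H X Y P : Prop :=
  P \subset H /\
  exists x y, [/\ path_with_ends P x y, x \in X & y \in Y].

(* (X, Y)-paths in G[H] *)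
Definition XY_path H X Y P : Prop :=
  joins H X Y P /\ forall Q, joins H X Y Q -> Q \subset P -> Q = P.

Record triple := Triple {
  stem : {set G};
  links : {set {set G}};
  target : {set G} }.

Implicit Type s : triple.

(* s is an l-seedling in G[H] *)
Definition seedling H (l : nat) s : Prop :=
  [/\ path_in H (stem s),
      target s \subset H :\: stem s,
      #|links s| = l,
      forall P Q, P \in links s -> Q \in links s -> P != Q -> [disjoint P & Q]
    & forall P, P \in links s ->
        XY_path (H :\: stem s) (neighborhood H (stem s)) (target s) P].

Definition support s : {set G} := stem s :|: cover (links s).

Definition disjoint_seedlings s s' : Prop := [disjoint support s & support s'].

(* k-rigidity of s as a seedling in G[H] *)
Definition rigid H (k : nat) s : Prop :=
  ~ exists K : {set {set G}},
    [/\ #|K| = k,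
        forall P, P \in K -> XY_path H (neighborhood H (stem s)) (target s) P,
        forall P Q, P \in K -> Q \in K -> P != Q -> anticomplete P Q
      & cover K \subset cover (links s)].

End Seedlings.

(* Main.v *)
Require Import Defs.
From mathcomp Require Import all_boot.
From Stdlib Require Import Classical.

(** Write each link as [x_i p_i], where [x_i] is its only vertex in [N(A)]; the
    [p_i] are anticomplete to [A].  Grow a prefix of each link as long as it
    touches fewer than [m] of the other [p_j].  Most of these prefixes can be made
    pairwise anticomplete, because a digraph of bounded out-degree has a large
    independent set and [G] has no large clique; fewer than [kappa] of them are
    whole links, by rigidity.  Adding one more vertex to each of the others gives
    the new stems, each touching [m] of the [p_j], and for large [m] these can be
    distributed so that every stem gets private links ending in [Y].

    If many of the new seedlings had [g] pairwise anticomplete paths violating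
    rigidity, then, as there is no [K_{t,t}] induced minor, one could pick one such
    path for each of [kappa] stems so that the unions of stem and path are pairwise
    anticomplete.  Each union contains an [(N(A), Y)]-path inside the original
    links, contradicting [kappa]-rigidity; so all but boundedly many of the new
    seedlings are rigid. *)

Set Implicit Arguments.
Unset Strict Implicit.
Unset Printing Implicit Defensive.

(** * Finite combinatorics *)

Lemma card_bigcup_leq (T U : finType) (A : {set T}) (F : T -> {set U}) :
  #|\bigcup_(i in A) F i| <= \sum_(i in A) #|F i|.
Proof.
apply: (big_ind2 (fun (X : {set U}) n => #|X| <= n)); rewrite ?cards0 //.
move=> X m Y n leX leY.
by apply: leq_trans (leq_add leX leY); rewrite cardsU leq_subr.
Qed.

Lemma subset_of_card (T : finType) (I : {set T}) n :
  n <= #|I| -> exists2 J : {set T}, J \subset I & #|J| = n.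
Proof.
elim: n => [|n IHn] le_nI; first by exists (set0 : {set T}); rewrite ?sub0set ?cards0.
have [J sJI cardJ] := IHn (ltnW le_nI).
have /subsetPn[i Ii notJi] : ~~ (I \subset J).
  by apply/negP => /subset_leq_card; rewrite cardJ leqNgt le_nI.
exists (i |: J); first by rewrite subUset sub1set Ii sJI.
by rewrite cardsU1 notJi cardJ.
Qed.

Section Counting.

Variable T : finType.
Implicit Types (I J : {set T}) (r : rel T).

(** Counting arcs twice yields an element of in-degree at most [d] inside [I]. Deleting it with its
    in- and out-neighbours costs at most [2 * d + 1] elements, and induction on [k] handles the
    rest. *)
Lemma sparse_independent r d k I :
  (forall i, i \in I -> #|[set j in I | (j != i) && r i j]| <= d) ->
  (2 * d + 1) * k <= #|I| ->
  exists J, [/\ J \subset I, #|J| = k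
    & forall i j, i \in J -> j \in J -> i != j -> ~~ r i j].
Proof.
elim: k I => [|k IHk] I outI leI.
  by exists (set0 : {set T}); split; rewrite ?sub0set ?cards0 // => i j; rewrite inE.
have [i0 Ii0 in_i0] : exists2 i0, i0 \in I
    & #|[set j in I | (j != i0) && r j i0]| <= d.
  apply/exists_inP; apply: contraT; rewrite negb_exists_in => /forall_inP allI.
  have sumE : \sum_(i in I) #|[set j in I | (j != i) && r i j]|
            = \sum_(i in I) #|[set j in I | (j != i) && r j i]|.
    transitivity (\sum_(i in I) \sum_(j in I) ((j != i) && r i j : nat)).
      apply: eq_bigr => i _; rewrite -sum1_card big_mkcond [RHS]big_mkcond.
      by apply: eq_bigr => j _; rewrite inE; case: (j \in I) => //=; case: (_ && _).
    rewrite exchange_big; apply: eq_bigr => i _.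
    rewrite -[RHS]sum1_card big_mkcond [RHS]big_mkcond.
    apply: eq_bigr => j _; rewrite inE eq_sym.
    by case: (j \in I) => //=; case: (_ && _).
  have le1 : \sum_(i in I) #|[set j in I | (j != i) && r i j]| <= #|I| * d.
    by rewrite -sum_nat_const; apply: leq_sum => i Ii; apply: outI.
  have le2 : #|I| * d.+1 <= \sum_(i in I) #|[set j in I | (j != i) && r j i]|.
    by rewrite -sum_nat_const; apply: leq_sum => i Ii; rewrite ltnNge allI.
  move: (leq_trans le2 (eq_leq (esym sumE))) => /leq_trans/(_ le1).
  rewrite mulnS -{2}[#|I| * d]add0n leq_add2r leqn0 => /eqP cI.
  by move: leI; rewrite cI leqn0 muln_eq0 addn1.
pose N := i0 |: ([set j in I | (j != i0) && r i0 j]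
             :|: [set j in I | (j != i0) && r j i0]).
have cN : #|N| <= 2 * d + 1.
  apply: leq_trans (leq_card_setU _ _).1 _; rewrite cards1 addnC leq_add2r.
  apply: leq_trans (leq_card_setU _ _).1 _; rewrite mul2n -addnn.
  by apply: leq_add in_i0; apply: outI.
have [||J [sJ cJ indJ]] := IHk (I :\: N).
- move=> i /setDP[Ii _]; apply: leq_trans (outI i Ii); apply: subset_leq_card.
  by apply/subsetP => j; rewrite !inE => /andP[/andP[_ ->]].
- rewrite -(leq_add2r (#|N|)) cardsD; apply: leq_trans (leq_trans leI _).
    by rewrite mulnS addnC leq_add2r.
  by rewrite addnC -leq_subLR leq_sub2l // subset_leq_card // subsetIr.
have notN j : j \in J -> j \in I /\ j \notin N.
  by move=> /(subsetP sJ) /setDP.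
have i0J j : j \in J -> j != i0 /\ ~~ r i0 j /\ ~~ r j i0.
  move=> /notN[Ij]; rewrite !inE Ij /= negb_or => /andP[->]/=.
  by rewrite negb_or => /andP.
exists (i0 |: J); split.
- rewrite subUset sub1set Ii0; apply: subset_trans sJ _; exact: subsetDl.
- rewrite cardsU1 cJ; case: (boolP (i0 \in J)) => // /i0J[].
  by rewrite eqxx.
- move=> i j /setU1P[->|Ji] /setU1P[->|Jj] neq; last exact: indJ.
  + by rewrite eqxx in neq.
  + by have [_ []] := i0J j Jj.
  + by have [_ []] := i0J i Ji.
Qed.

(** Greedy choice: each reservation removes at most [l] elements from every other set, so [n * l]
    elements last for [n] rounds. *)
Lemma disjoint_representatives (U : finType) (D : T -> {set U}) l n J :
  #|J| <= n -> (forall i, i \in J -> n * l <= #|D i|) ->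
  exists c : T -> {set U},
    [/\ forall i, i \in J -> c i \subset D i,
        forall i, i \in J -> #|c i| = l
      & forall i j, i \in J -> j \in J -> i != j -> [disjoint c i & c j]].
Proof.
elim: n J D => [|n IHn] J D leJ leD.
  have J0 : J = set0 by apply/eqP; rewrite -cards_eq0 -leqn0.
  by exists (fun=> set0); rewrite J0; split=> i; rewrite inE.
have [->|[i0 Ji0]] := set_0Vmem J.
  by exists (fun=> set0); split=> i; rewrite inE.
have [E sE cE] : exists2 E : {set U}, E \subset D i0 & #|E| = l.
  apply: subset_of_card; apply: leq_trans (leD _ Ji0).
  by rewrite mulSn leq_addr.
have [||c [c1 c2 c3]] := IHn (J :\ i0) (fun i => D i :\: E).
- by move: leJ; rewrite (cardsD1 i0) Ji0.
- move=> i /setD1P[_ Ji]; rewrite cardsD.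
  have := leD i Ji; rewrite mulSn => le1.
  rewrite -(leq_add2l l); apply: (leq_trans le1); rewrite -leq_subLR leq_sub2l //.
  by rewrite -cE subset_leq_card // subsetIr.
exists (fun i => if i == i0 then E else c i); split.
- move=> i Ji; case: eqP => [->//|/eqP ni].
  by apply: subset_trans (c1 i _) (subsetDl _ _); rewrite !inE ni.
- by move=> i Ji; case: eqP => [_ //|/eqP ni]; apply: c2; rewrite !inE ni.
- have dE i : i \in J -> i != i0 -> [disjoint c i & E].
    move=> Ji ni; have := c1 i; rewrite !inE ni Ji => /(_ isT).
    by rewrite subsetD => /andP[].
  move=> i j Ji Jj.
  case: (eqVneq i i0) => [ii0|ni]; case: (eqVneq j i0) => [ji0|nj].
  + by rewrite ii0 ji0 eqxx.
  + by move=> _; rewrite disjoint_sym; apply: dE.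
  + by move=> _; apply: dE.
  + by move=> nij; apply: c3 => //; rewrite !inE ?ni ?nj.
Qed.

Lemma pigeonhole (U : finType) (h : T -> U) I (Z : {set U}) m :
  (forall i, i \in I -> h i \in Z) -> #|Z| * m < #|I| ->
  exists2 z, z \in Z & m < #|[set i in I | h i == z]|.
Proof.
move=> hZ lt; apply/exists_inP; apply: contraLR lt.
rewrite negb_exists_in -leqNgt => /forall_inP le.
rewrite -sum1_card (partition_big h (mem Z)) //= -sum_nat_const.
apply: leq_sum => z Zz; have := le z Zz; rewrite -leqNgt; apply: leq_trans.
by rewrite sum1_card; apply: subset_leq_card; apply/subsetP => i; rewrite !inE.
Qed.

(* The recurrence leaves room, at each choice, for at most [t] bad
   candidates per remaining row. *)
Fixpoint transversal_size t n :=
  if n is n'.+1 then t * transversal_size t n' + t + n' * t + 1 else 1.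

Lemma transversal_sizeS t n : transversal_size t n.+1 =
  t * transversal_size t n + t + n * t + 1.
Proof. by []. Qed.

(** Greedy choice row by row. A candidate is bad for another row if it has too few non-neighbours
    there; [t] candidates bad for the same row would have [t] common neighbours in it, a forbidden
    biclique. So some candidate is good for all rows, and the choice continues among its
    non-neighbours. [u0] is the value of [q] off [J]. *)
Lemma independent_transversal (U : finType) (u0 : U) (E : rel U) t J
    (R : T -> {set U}) :
  symmetric E ->
  (forall i, i \in J -> transversal_size t #|J| <= #|R i|) ->
  (forall i j (A B : {set U}), i \in J -> j \in J -> i != j ->
     A \subset R i -> B \subset R j -> #|A| = t -> #|B| = t ->
     ~ {in A & B, forall a b, E a b}) ->
  exists q : T -> U, (forall i, i \in J -> q i \in R i) /\
    (forall i j, i \in J -> j \in J -> i != j -> ~~ E (q i) (q j)).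
Proof.
move=> symE; move: {2}#|J| (erefl #|J|) => n; elim: n J R => [|n IHn] J R cJ.
  have J0 : J = set0 by apply/eqP; rewrite -cards_eq0 cJ.
  by move=> _ _; exists (fun=> u0); rewrite J0; split=> [i|i j]; rewrite inE.
rewrite cJ transversal_sizeS => leR noK.
have /card_gt0P[i0 Ji0] : 0 < #|J| by rewrite cJ.
have cJ' : #|J :\ i0| = n by move: cJ; rewrite (cardsD1 i0) Ji0 => -[].
pose bad j := [set a in R i0
                | #|[set b in R j | ~~ E a b]| < transversal_size t n].
have cbad j : j \in J :\ i0 -> #|bad j| <= t.
  case/setD1P=> nj Jj; rewrite leqNgt; apply/negP => /ltnW /subset_of_card.
  case=> A sA cA.
  (* [N] is small because the candidates in [A] are bad, and everything in [R j] outside [N] is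
     joined to all of [A]. *)
  pose N := \bigcup_(a in A) [set b in R j | ~~ E a b].
  have cN : #|N| <= t * transversal_size t n.
    rewrite -{1}cA -sum_nat_const; apply: leq_trans (card_bigcup_leq _ _) _.
    by apply: leq_sum => a /(subsetP sA); rewrite inE => /andP[_ /ltnW].
  have /subset_of_card[B sB cB] : t <= #|R j :\: N|.
    rewrite cardsD leq_subRL; last first.
      exact: subset_leq_card (subsetIl _ _).
    apply: leq_trans (leR j Jj); rewrite -!addnA addnA.
    apply: leq_trans (leq_addr _ _); rewrite leq_add2r.
    by apply: leq_trans cN; apply: subset_leq_card (subsetIr _ _).
  apply: (noK i0 j A B); rewrite // 1?eq_sym //.
  - by apply: subset_trans sA _; apply/subsetP => a; rewrite inE => /andP[].
  - exact: subset_trans sB (subsetDl _ _).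
  - move=> a b Aa /(subsetP sB)/setDP[Rb]; apply: contraR => nE.
    by apply/bigcupP; exists a => //; rewrite inE Rb.
have [a Ra good_a] : exists2 a, a \in R i0
    & forall j, j \in J :\ i0 ->
        transversal_size t n <= #|[set b in R j | ~~ E a b]|.
  have /subsetPn[a Ra nbad] : ~~ (R i0 \subset \bigcup_(j in J :\ i0) bad j).
    apply/negP => /subset_leq_card; apply/negP; rewrite -ltnNge.
    apply: leq_ltn_trans (_ : n * t < _).
      apply: leq_trans (card_bigcup_leq _ _) _.
      by rewrite -cJ' -sum_nat_const; apply: leq_sum => j; apply: cbad.
    by apply: leq_trans (leR _ Ji0); rewrite addn1 ltnS leq_addl.
  exists a => // j Jj; rewrite leqNgt; apply: contra nbad => lt.
  by apply/bigcupP; exists j; rewrite // inE Ra.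
have [||q [q1 q2]] := IHn (J :\ i0) (fun j => [set b in R j | ~~ E a b]) cJ'.
- by move=> j Jj; rewrite cJ'; apply: good_a.
- move=> i j A B /setD1P[_ Ji] /setD1P[_ Jj] nij sA sB; apply: (noK i j) => //.
  + by apply: subset_trans sA _; apply/subsetP => b; rewrite inE => /andP[].
  + by apply: subset_trans sB _; apply/subsetP => b; rewrite inE => /andP[].
have q1' j : j \in J -> j != i0 -> q j \in R j /\ ~~ E a (q j).
  by move=> Jj nj; have := q1 j; rewrite !inE nj Jj => /(_ isT)/andP.
exists (fun j => if j == i0 then a else q j); split=> [j Jj|i j Ji Jj].
  by case: eqP => [->//|/eqP nj]; case: (q1' j Jj nj).
case: (eqVneq i i0) => [ii0|ni]; case: (eqVneq j i0) => [ji0|nj] nij.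
- by rewrite ii0 ji0 eqxx in nij.
- by case: (q1' j Jj nj).
- by rewrite symE; case: (q1' i Ji ni).
- by apply: q2; rewrite // !inE ?ni ?nj.
Qed.

End Counting.

(** * Connected sets *)

Section Connectivity.

Variable G : sgraph.
Implicit Types (C H P Q X Y : {set G}) (x y : G) (p : seq G).

Definition touch X Y : bool := [exists x in X, exists y in Y, x -- y].

Definition apart X Y : bool := [disjoint X & Y] && ~~ touch X Y.

(** The empty set qualifies, so nonemptiness is ensured separately where it matters. *)
Definition conn X : Prop :=
  {in X &, forall x y, connect [rel u v | [&& u \in X, v \in X & u -- v]] x y}.

Lemma touchP X Y :
  reflect (exists x y, [/\ x \in X, y \in Y & x -- y]) (touch X Y).
Proof.
apply: (iffP exists_inP) => [[x Xx /exists_inP[y Yy xy]]|[x [y [Xx Yy xy]]]].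
  by exists x, y.
by exists x => //; apply/exists_inP; exists y.
Qed.

Lemma touch_sym X Y : touch X Y = touch Y X.
Proof.
by apply/touchP/touchP => -[x [y [Xx Yy xy]]]; exists y, x; rewrite edge_sym.
Qed.

Lemma touchS X X' Y Y' :
  X \subset X' -> Y \subset Y' -> touch X Y -> touch X' Y'.
Proof.
move=> /subsetP sX /subsetP sY /touchP[x [y [Xx Yy xy]]].
by apply/touchP; exists x, y; rewrite sX // sY.
Qed.

Lemma anticompleteP X Y : reflect (anticomplete X Y) (apart X Y).
Proof.
apply: (iffP andP) => -[dXY nXY]; split=> //.
  by move=> x y Xx Yy; apply: contra nXY => xy; apply/touchP; exists x, y.
by apply/touchP => -[x [y [Xx Yy xy]]]; have := nXY x y Xx Yy; rewrite xy.
Qed.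

Lemma apart_sym X Y : apart X Y = apart Y X.
Proof. by rewrite /apart disjoint_sym touch_sym. Qed.

Lemma apartS X X' Y Y' :
  X \subset X' -> Y \subset Y' -> apart X' Y' -> apart X Y.
Proof.
move=> sX sY /andP[dXY nXY]; apply/andP; split.
  exact: disjointWl sX (disjointWr sY dXY).
by apply: contra nXY; apply: touchS.
Qed.

Lemma apartUl X X' Y : apart (X :|: X') Y = apart X Y && apart X' Y.
Proof.
rewrite /apart.
have -> : [disjoint X :|: X' & Y] = [disjoint X & Y] && [disjoint X' & Y].
  by rewrite -disjointU; apply: eq_disjoint => x; rewrite !inE.
apply/idP/idP.
  move=> /andP[/andP[-> ->] nt] /=; rewrite -negb_or; apply: contra nt.
  by case/orP; apply: touchS; rewrite ?subsetUl ?subsetUr.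
move=> /andP[/andP[-> n1] /andP[-> n2]] /=.
apply/touchP => -[x [y [/setUP[Xx|Xx] Yy xy]]].
  by case/touchP: n1; exists x, y.
by case/touchP: n2; exists x, y.
Qed.

Lemma apartUr X Y Y' : apart X (Y :|: Y') = apart X Y && apart X Y'.
Proof. by rewrite apart_sym apartUl !(apart_sym X). Qed.

Lemma conn_seq x p : path (@edge G) x p -> conn [set z in x :: p].
Proof.
move=> pth; pose e := [rel u v | [&& u \in [set z in x :: p],
                                  v \in [set z in x :: p] & u -- v]].
have syme : connect_sym e.
  by apply: sym_connect_sym => u v /=; rewrite andbCA edge_sym.
have fromx z : z \in [set z in x :: p] -> connect e x z.
  rewrite inE; case/splitPl def_p : p / => [p1 p2 lst]; apply/connectP; exists p1 => //.
  have pth1 : path (@edge G) x p1 by move: pth; rewrite def_p cat_path => /andP[].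
  apply: (sub_in_path (P := [in x :: p])) pth1 => [u v xu xv uv|].
    by rewrite /= !inE uv andbT; apply/andP.
  by apply/allP => u; rewrite def_p -cat_cons mem_cat => ->.
move=> u v Xu Xv; apply: connect_trans (fromx v Xv).
by rewrite syme; apply: fromx.
Qed.

Lemma connU X Y : conn X -> conn Y -> touch X Y -> conn (X :|: Y).
Proof.
move=> cX cY /touchP[x0 [y0 [Xx0 Yy0 xy0]]].
set e := [rel u v | [&& u \in X :|: Y, v \in X :|: Y & u -- v]].
have syme : connect_sym e.
  by apply: sym_connect_sym => u v /=; rewrite andbCA edge_sym.
have toX : {in X &, forall u v, connect e u v}.
  move=> u v Xu Xv; apply: connect_sub (cX u v Xu Xv) => a b /and3P[Xa Xb ab].
  by apply: connect1; rewrite /= !inE Xa Xb.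
have toY : {in Y &, forall u v, connect e u v}.
  move=> u v Yu Yv; apply: connect_sub (cY u v Yu Yv) => a b /and3P[Xa Xb ab].
  by apply: connect1; rewrite /= !inE Xa Xb !orbT.
have c0 : connect e x0 y0 by apply: connect1; rewrite /= !inE Xx0 Yy0 orbT.
have from0 u : u \in X :|: Y -> connect e x0 u.
  case/setUP=> Xu; first exact: toX.
  by apply: connect_trans c0 _; apply: toY.
move=> u v /from0 Xu /from0 Xv; apply: connect_trans Xv.
by rewrite syme.
Qed.

Lemma induced_path_path x p : induced_path_seq x p -> path (@edge G) x p.
Proof.
case=> _ adj; apply/(pathP x) => i lt; have := adj i i.+1.
by rewrite /= !ltnS lt (ltnW lt) eqxx => ->.
Qed.

(** A shortest path inside [C] is induced, because a chord would give a shortcut. *)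
Lemma induced_path_exists C x y : conn C -> x \in C -> y \in C ->
  exists p, [/\ induced_path_seq x p, last x p = y & {subset x :: p <= C}].
Proof.
move=> cC Cx Cy.
set e := [rel u v | [&& u \in C, v \in C & u -- v]].
have [p0 pth0 lst0] := connectP (cC x y Cx Cy).
have [n le] := ubnP (size p0).
elim: n p0 pth0 lst0 le => // n IHn p pth lst le.
have [[q [pthq lstq szq]]|nosh] :=
    classic (exists q, [/\ path e x q, y = last x q & size q < size p]).
  by apply: (IHn q) => //; apply: leq_trans szq _.
have {nosh pth lst} [q [pth uq lst nosh]] : exists q,
    [/\ path e x q, uniq (x :: q), y = last x q
      & forall q', path e x q' -> y = last x q' -> size q <= size q'].
  case: (shortenP pth) lst => q pthq uq sq lst; exists q; split=> // q' pthq' lstq'.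
  apply: (@leq_trans (size p)).
    by apply: uniq_leq_size; case/andP: uq.
  by rewrite leqNgt; apply/negP => lt; case: nosh; exists q'.
have adj i j : i < j -> j < size (x :: q) ->
    nth x (x :: q) i -- nth x (x :: q) j = (i.+1 == j).
  move=> ltij ltj; apply/idP/eqP => [ij|<-]; last first.
    have lti : i < size q by rewrite -ltnS; apply: leq_ltn_trans ltj.
    by have /(pathP x)/(_ i lti)/and3P[] := pth.
  apply/eqP; rewrite eqn_leq ltij /= leqNgt; apply/negP => ltij'.
  (* The upper end of the chord is at position [j.+1] of [x :: q], hence at [j] of [q];
     [take i q ++ drop j q] follows the chord and is shorter than [q]. *)
  case: j ltj ltij ltij' ij => // j; rewrite !ltnS => ltj leij ltij ij.
  have dropE : drop j q = nth x q j :: drop j.+1 q by rewrite (drop_nth x).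
  have lti : i <= size q := leq_trans (ltnW ltij) (ltnW ltj).
  have lastE : last x (take i q) = nth x (x :: q) i.
    by rewrite (last_nth x) size_takel // -[x :: take i q]/(take i.+1 (x :: q)) nth_take.
  have memC k : k <= size q -> nth x (x :: q) k \in C.
    case: k => [//|k ltk]; by have /(pathP x)/(_ k ltk)/and3P[] := pth.
  have := nosh (take i q ++ drop j q); rewrite cat_path last_cat lastE dropE /=.
  move: (pth) (lst); rewrite -{1 2}(cat_take_drop j q) cat_path dropE last_cat /=.
  case/and3P=> pthj _ -> ->.
  have -> : path e x (take i q).
    by move: pth; rewrite -{1}(cat_take_drop i q) cat_path => /andP[].
  rewrite !memC //= (memC j.+1) // ij => /(_ isT erefl).
  rewrite size_cat /= size_takel // size_drop subnSK // leqNgt => /negP[].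
  by have := ltn_add2r (size q - j) i j; rewrite (subnKC (ltnW ltj)) => ->.
exists q; split=> //.
- split=> // i j lti ltj; case: (ltngtP i j) => [lt|lt|->].
  + rewrite adj // [j.+1 == i]gtn_eqF ?orbF //; exact: ltnW.
  + by rewrite edge_sym adj // [i.+1 == j]gtn_eqF // ltnW.
  + by rewrite edge_irrefl gtn_eqF.
- move=> z; rewrite inE => /predU1P[->//|]; case/splitPr def_q: q / => [p1 p2].
  by move: pth; rewrite def_q cat_path /= => /andP[_ /andP[/and3P[]]].
Qed.

(** An induced path inside [C] joins [X] to [Y], and an inclusion-minimal joining subset of it is as
    required. New paths are obtained this way, so that only connectivity has to be arranged. *)
Lemma XY_path_exists C H X Y : conn C -> C \subset H ->
  (exists2 x, x \in C & x \in X) -> (exists2 y, y \in C & y \in Y) ->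
  exists2 P : {set G}, P \subset C & XY_path H X Y P.
Proof.
move=> cC sCH [x Cx Xx] [y Cy Yy].
have [p [ip lp sp]] := induced_path_exists cC Cx Cy.
have sPC : [set z in x :: p] \subset C by apply/subsetP => z; rewrite inE; apply: sp.
have : joins H X Y [set z in x :: p].
  by split; [apply: subset_trans sPC sCH | exists x, y; split=> //; exists p].
move: [set z in x :: p] sPC => P; have [n] := ubnP #|P|.
elim: n P => // n IHn P ltP sPC jP.
have [[Q [jQ sQP nQP]]|minP] :=
    classic (exists Q, [/\ joins H X Y Q, Q \subset P & Q <> P]).
  apply: (IHn Q) => //; last exact: subset_trans sQP sPC.
  have: Q \proper P by rewrite properEneq sQP andbT; apply/eqP.
  by move/proper_card/leq_trans; apply.
exists P => //; split=> // Q jQ sQP; apply: NNPP => nQP.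
by apply: minP; exists Q.
Qed.

End Connectivity.

(** * Induced minors and stable sets *)

Lemma induced_minor_of_branch_sets (G H : sgraph) (u0 : H) (B : H -> {set G}) :
  (forall u, conn (B u)) -> (forall u, B u != set0) ->
  (forall u v, u != v -> [disjoint B u & B v]) ->
  (forall u v, u != v -> u -- v = touch (B u) (B v)) ->
  has_induced_minor G H.
Proof.
move=> connB neB disB adjB.
(* [F] consists of the edges inside branch sets, so its components on their union are exactly these
   sets; [phi] names the branch set of a vertex, with default [u0] outside the union. *)
pose F x y := [exists u, [&& x \in B u, y \in B u & x -- y]].
pose phi x := odflt u0 [pick u | x \in B u].
have phiE u x : x \in B u -> phi x = u.
  rewrite /phi; case: pickP => [v /= Bv Bu|/(_ u) /= ->//].
  apply/eqP; apply: contraT => nuv.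
  by have /pred0P/(_ x) := disB v u nuv; rewrite /= Bv Bu.
have inS u x : x \in B u -> x \in \bigcup_v B v.
  by move=> Bx; apply/bigcupP; exists u.
exists (\bigcup_u B u), F, phi; split.
- by move=> x y; apply: eq_existsb => u; rewrite andbCA edge_sym.
- by move=> x y /existsP[u /and3P[Bx By xy]]; split=> //; apply: inS; eauto.
- by move=> u; have /set0Pn[x Bx] := neB u; exists x; [apply: inS Bx | apply: phiE].
- move=> x y /bigcupP[u _ Bx] /bigcupP[v _ By]; rewrite (phiE u) // (phiE v) //.
  split=> [uv|].
    move: Bx; rewrite uv => Bx; apply: connect_sub (connB v x y Bx By) => a b /= e.
    by apply: connect1; apply/existsP; exists v.
  case/connectP=> p pth y_def.
  have inv z q : z \in B u -> path F z q -> last z q \in B u.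
    elim: q z => //= a q IHq z Bz /andP[/existsP[w /and3P[Bz' Ba _]]].
    by apply: IHq; rewrite -(phiE u z Bz) (phiE w z Bz').
  by rewrite -(phiE u y) ?(phiE v y) // y_def; apply: inv.
- move=> u v; split=> [uv|[/eqP nuv [x [y [/bigcupP[a _ Bx] /bigcupP[b _ By]]]]]].
    have nuv : u != v by apply: contraTneq uv => ->; rewrite edge_irrefl.
    split; first exact/eqP.
    move: uv; rewrite adjB // => /touchP[x [y [Bx By xy]]].
    exists x, y; split=> //; [exact: inS Bx | exact: inS By | |];
      exact: phiE.
  rewrite (phiE a) // (phiE b) // => au bv xy; subst a b.
  by rewrite adjB //; apply/touchP; exists x, y.
Qed.

(** The two families would be the branch sets of a [K_{t,t}] induced minor. Arbitrary index sets
    allow both stems and paths as branch sets; nonemptiness follows from touching, since [t] is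
    positive. *)
Lemma tidy_no_biclique t (G : sgraph) (T1 T2 : finType) (A : {set T1})
    (B : {set T2}) (P : T1 -> {set G}) (Q : T2 -> {set G}) :
  tidy t G -> 0 < t -> #|A| = t -> #|B| = t ->
  {in A, forall a, conn (P a)} -> {in B, forall b, conn (Q b)} ->
  {in A &, forall a a', a != a' -> apart (P a) (P a')} ->
  {in B &, forall b b', b != b' -> apart (Q b) (Q b')} ->
  {in A & B, forall a b, [disjoint P a & Q b]} ->
  ~ {in A & B, forall a b, touch (P a) (Q b)}.
Proof.
move=> [_ noK] t_gt0 cA cB cP cQ aP aQ dPQ tPQ; apply: noK.
have /card_gt0P[a0 Aa0] : 0 < #|A| by rewrite cA.
have /card_gt0P[b0 Bb0] : 0 < #|B| by rewrite cB.
pose a i := enum_val (cast_ord (esym cA) i).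
pose b i := enum_val (cast_ord (esym cB) i).
have Aa i : a i \in A by apply: enum_valP.
have Bb i : b i \in B by apply: enum_valP.
have inja i j : i != j -> a i != a j.
  by apply: contraNneq => /enum_val_inj /cast_ord_inj ->.
have injb i j : i != j -> b i != b j.
  by apply: contraNneq => /enum_val_inj /cast_ord_inj ->.
pose W (u : complete_bipartite t t) : {set G} :=
  match u with inl i => P (a i) | inr i => Q (b i) end.
pose u0 : complete_bipartite t t := inl (Ordinal t_gt0).
apply: (induced_minor_of_branch_sets u0 (B := W)).
- by case=> i /=; [apply: cP | apply: cQ].
- case=> i /=.
    have /touchP[x [y [Px _ _]]] := tPQ _ _ (Aa i) Bb0; by apply/set0Pn; exists x.
  have /touchP[x [y [_ Qy _]]] := tPQ _ _ Aa0 (Bb i); by apply/set0Pn; exists y.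
- case=> i [] j neq /=.
  + have /andP[] // : apart (P (a i)) (P (a j)).
    by apply: aP => //; apply: inja; apply: contraNneq neq => ->.
  + exact: dPQ.
  + by rewrite disjoint_sym; apply: dPQ.
  + have /andP[] // : apart (Q (b i)) (Q (b j)).
    by apply: aQ => //; apply: injb; apply: contraNneq neq => ->.
- case=> i [] j neq /=.
  + have /andP[_ /negPf->] // : apart (P (a i)) (P (a j)).
    by apply: aP => //; apply: inja; apply: contraNneq neq => ->.
  + by rewrite tPQ.
  + by rewrite touch_sym tPQ.
  + have /andP[_ /negPf->] // : apart (Q (b i)) (Q (b j)).
    by apply: aQ => //; apply: injb; apply: contraNneq neq => ->.
Qed.

(** A Ramsey bound, equal to [1 + n + ... + n^t]: that many vertices force a stable set of size [n]
    or a clique of size [t.+1]. *)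
Fixpoint ramsey_size n t :=
  if t is t'.+1 then n * ramsey_size n t' + 1 else 1.

Lemma ramsey_size_gt0 n t : 0 < ramsey_size n t.
Proof. by case: t => //= t; rewrite addn1. Qed.

(** Induction on [t]. A maximal stable set with fewer than [n] elements dominates [I], so one of its
    members has at least [ramsey_size n t] neighbours, among which the forbidden clique size drops
    by one. *)
Lemma stable_subset (T : finType) (e : rel T) n t (I : {set T}) :
  symmetric e ->
  (forall J : {set T}, J \subset I -> #|J| = t.+1 ->
     ~ {in J &, forall i j, i != j -> e i j}) ->
  ramsey_size n t <= #|I| ->
  exists J : {set T}, [/\ J \subset I, #|J| = n
    & {in J &, forall i j, i != j -> ~~ e i j}].
Proof.
move=> syme; elim: t I => [|t IHt] I noK leI.
  have [J sJ cJ] := subset_of_card leI; case: (noK J sJ cJ) => i j.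
  by have /eqP/cards1P[a ->] := cJ; move=> /set1P-> /set1P->; rewrite eqxx.
pose stable (J : {set T}) := (J \subset I)
  && [forall i in J, forall j in J, (i != j) ==> ~~ e i j].
have [|J /maxsetP[/andP[sJ /forall_inP stJ] maxJ]] := @ex_maxset T stable.
  by exists set0; rewrite /stable sub0set; apply/forall_inP => i; rewrite inE.
have stJ' : {in J &, forall i j, i != j -> ~~ e i j}.
  by move=> i j Ji Jj; have /forall_inP/(_ j Jj)/implyP := stJ i Ji.
have [/subset_of_card[J' sJ' cJ']|ltJ] := leqP n #|J|.
  exists J'; split=> //; first exact: subset_trans sJ' sJ.
  by move=> i j /(subsetP sJ') Ji /(subsetP sJ') Jj; apply: stJ'.
have [j Jj leN] : exists2 j, j \in J
    & ramsey_size n t < #|[set i in I | (i == j) || e i j]|.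
  apply/exists_inP; apply: contraLR leI; rewrite negb_exists_in => /forall_inP le.
  rewrite -ltnNge [ramsey_size n t.+1]/= addn1 ltnS.
  have sI : I \subset \bigcup_(j in J) [set i in I | (i == j) || e i j].
    apply/subsetP => i Ii; apply/bigcupP; apply: NNPP => nJ.
    have nij j : j \in J -> (i != j) && ~~ e i j.
      move=> Jj; rewrite -negb_or; apply/negP => h; case: nJ.
      by exists j; rewrite // inE Ii.
    have niJ : i \notin J by apply/negP => /nij; rewrite eqxx.
    have sJi : J \subset i |: J by apply: subsetUr.
    case/negP: niJ; rewrite -(maxJ (i |: J)) ?setU11 //.
    rewrite /stable subUset sub1set Ii sJ /=; apply/forall_inP => a Ja.
    apply/forall_inP => b Jb; apply/implyP.
    case/setU1P: Ja => [->|Ja]; case/setU1P: Jb => [->|Jb]; rewrite ?eqxx //.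
    - by have /andP[] := nij b Jb.
    - by rewrite syme; have /andP[] := nij a Ja.
    - exact: stJ'.
  apply: leq_trans (subset_leq_card sI) _; apply: leq_trans (card_bigcup_leq _ _) _.
  apply: (@leq_trans (#|J| * ramsey_size n t)); last by rewrite leq_mul2r ltnW ?orbT.
  by rewrite -sum_nat_const; apply: leq_sum => j /le; rewrite -leqNgt.
have [||J' [sJ' cJ' stJ2]] := IHt [set i in I | (i != j) && e i j].
- move=> K sK cK allK; apply: (noK (j |: K)).
  + rewrite subUset sub1set (subsetP sJ) //=; apply: subset_trans sK _.
    by apply/subsetP => i; rewrite inE => /andP[].
  + rewrite cardsU1 cK (_ : j \notin K) //.
    by apply/negP => /(subsetP sK); rewrite inE eqxx andbF.
  + have Kj i : i \in K -> e i j by move/(subsetP sK); rewrite inE => /and3P[].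
    move=> a b /setU1P[->|Ka] /setU1P[->|Kb]; rewrite ?eqxx //.
    * by rewrite syme Kj.
    * by rewrite Kj.
    * exact: allK.
- rewrite -ltnS; apply: leq_trans leN _.
  rewrite (cardsD1 j) -add1n leq_add ?leq_b1 //; apply: subset_leq_card.
  by apply/subsetP => i; rewrite !inE; case: eqP => //= _.
exists J'; split=> //; apply: subset_trans sJ' _.
by apply/subsetP => i; rewrite inE => /andP[].
Qed.

Lemma tidy_stable t (G : sgraph) (T : finType) (I : {set T}) (h : T -> G) n :
  tidy t G -> {in I &, injective h} -> ramsey_size n t <= #|I| ->
  exists J : {set T}, [/\ J \subset I, #|J| = n
    & {in J &, forall i j, i != j -> ~~ (h i -- h j)}].
Proof.
move=> [noK _] injh leI.
apply: (@stable_subset T (fun i j => h i -- h j) n t I) => //.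
  by move=> i j; apply: edge_sym.
move=> J sJ cJ adj; apply: noK.
pose a i := enum_val (cast_ord (esym cJ) i).
have Ja i : a i \in J by apply: enum_valP.
have inja : injective a by move=> i j /enum_val_inj /cast_ord_inj.
exists (h \o a); split=> [i j /= eqh|i j /= nij].
  by apply: inja; apply: injh => //; apply: (subsetP sJ).
by apply: adj => //; apply: contraNneq nij => /inja ->.
Qed.

(** * Rigidity *)

Lemma joins_conn (G : sgraph) (H X Y P : {set G}) : joins H X Y P ->
  [/\ conn P, exists2 x, x \in P & x \in X & exists2 y, y \in P & y \in Y].
Proof.
case=> _ [x [y [[p [ip lp ->]] Xx Yy]]]; split.
- exact: conn_seq (induced_path_path ip).
- by exists x => //; rewrite inE mem_head.
- by exists y => //; rewrite inE -lp mem_last.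
Qed.

(** The form in which rigidity of the original seedling is used: connected sets suffice, since each
    contains a suitable path and these paths inherit being pairwise apart. *)
Lemma rigid_no_family (G : sgraph) k (s : triple G) (T : finType) (J : {set T})
    (C : T -> {set G}) :
  rigid [set: G] k s -> #|J| = k ->
  {in J, forall i, conn (C i)} ->
  {in J, forall i, C i \subset cover (links s)} ->
  {in J, forall i, exists2 x, x \in C i & x \in neighborhood [set: G] (stem s)} ->
  {in J, forall i, exists2 y, y \in C i & y \in target s} ->
  ~ {in J &, forall i j, i != j -> apart (C i) (C j)}.
Proof.
move=> rig cJ cC sC xC yC aC.
have /fin_all_exists[P PP] i : exists P : {set G}, i \in J ->
    P \subset C i /\ XY_path [set: G] (neighborhood [set: G] (stem s)) (target s) P.
  case: (boolP (i \in J)) => [Ji|_]; last by exists set0.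
  have [P sP XYP] := XY_path_exists (cC i Ji) (subsetT _) (xC i Ji) (yC i Ji).
  by exists P.
have aP : {in J &, forall i j, i != j -> apart (P i) (P j)}.
  move=> i j Ji Jj nij.
  by apply: apartS (aC i j Ji Jj nij); [case: (PP i Ji) | case: (PP j Jj)].
apply: rig; exists [set P i | i in J]; split.
(* The paths are nonempty and disjoint, hence distinct, so there are really [k] of them. *)
- rewrite card_in_imset // => i j Ji Jj eqP; apply: contraTeq (Ji) => nij.
  have /andP[/pred0P dP _] := aP i j Ji Jj nij.
  have [_ [/joins_conn[_ [x Px _] _] _]] := PP i Ji.
  by have := dP x; rewrite /= -eqP Px.
- by move=> _ /imsetP[i Ji ->]; case: (PP i Ji).
- move=> _ _ /imsetP[i Ji ->] /imsetP[j Jj ->] nij; apply/anticompleteP.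
  by apply: aP => //; apply: contraNneq nij => ->.
- apply/bigcupsP => _ /imsetP[i Ji ->]; case: (PP i Ji) => sP _.
  exact: subset_trans sP (sC i Ji).
Qed.

(** [S i] is a stem, [K i] a family of paths violating its rigidity, [V i] a territory containing
    both. The obstruction is a [K_{t,t}] induced minor twice: [t] paths against [t] stems when paths
    are separated from foreign stems, then [t] paths against [t] paths when one path per stem is
    picked. *)
Lemma witness_transversal (G : sgraph) t k (T : finType) (B : {set T})
    (S V : T -> {set G}) (K : T -> {set {set G}}) :
  tidy t G -> 0 < t -> #|B| = (2 * t + 1) * k ->
  {in B, forall i, 2 ^ #|B| * (transversal_size t k + t) < #|K i|} ->
  {in B, forall i, conn (S i)} ->
  {in B, forall i, {in K i, forall Q, conn Q}} ->
  {in B, forall i, {in K i &, forall Q Q', Q != Q' -> apart Q Q'}} ->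
  {in B &, forall i j, i != j -> apart (S i) (S j)} ->
  {in B, forall i, S i \subset V i} ->
  {in B, forall i, {in K i, forall Q : {set G}, Q \subset V i}} ->
  {in B &, forall i j, i != j -> [disjoint V i & V j]} ->
  exists (J : {set T}) (q : T -> {set G}),
    [/\ J \subset B, #|J| = k, {in J, forall i, q i \in K i}
      & {in J &, forall i j, i != j -> apart (S i :|: q i) (S j :|: q j)}].
Proof.
move=> tdy t_gt0 cB leK cS cK aK aS sS sK dV.
pose h i Q := [set j in B | (j != i) && touch Q (S j)].
have dKS i j Q : i \in B -> j \in B -> i != j -> Q \in K i -> [disjoint Q & S j].
  move=> Bi Bj nij KQ; apply: disjointW (dV i j Bi Bj nij); last exact: sS.
  exact: sK KQ.
(* The set of other stems touched by a path takes at most [2 ^ #|B|] values, so many paths of [K i]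
   share one value [z i]. If it had more than [t] members, [t] of them and [t] of these paths would
   form a biclique. *)
have /fin_all_exists[z zP] i : exists z : {set T}, i \in B ->
    transversal_size t k + t < #|[set Q in K i | h i Q == z]| /\ #|z| <= t.
  case: (boolP (i \in B)) => [Bi|_]; last by exists set0.
  have [||z _ lez] := @pigeonhole _ _ (h i) (K i) (powerset B) (transversal_size t k + t).
  - move=> Q _; rewrite powersetE; apply/subsetP => j.
    by rewrite inE => /andP[].
  - by rewrite card_powerset; apply: leK.
  exists z => _; split=> //; rewrite leqNgt; apply/negP.
  move=> /ltnW/subset_of_card[Z sZ cZ].
  have /subset_of_card[A sA cA] : t <= #|[set Q in K i | h i Q == z]|.
    by apply: leq_trans (ltnW lez); apply: leq_addl.
  have AP Q : Q \in A -> Q \in K i /\ h i Q = z.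
    by move=> /(subsetP sA); rewrite inE => /andP[KQ /eqP].
  have ZP Q j : Q \in A -> j \in Z -> [/\ j \in B, i != j & touch Q (S j)].
    move=> /AP[_ hQ] /(subsetP sZ); rewrite -hQ inE => /andP[-> /andP[nji ->]].
    by rewrite eq_sym.
  have /card_gt0P[Q0 AQ0] : 0 < #|A| by rewrite cA.
  apply: (tidy_no_biclique tdy t_gt0 cA cZ (P := id) (Q := S)).
  - by move=> Q /AP[KQ _]; apply: (cK i Bi).
  - by move=> j /(ZP Q0 j AQ0)[Bj _ _]; apply: cS.
  - by move=> Q Q' /AP[KQ _] /AP[KQ' _]; apply: (aK i Bi).
  - by move=> j j' /(ZP Q0 j AQ0)[Bj _ _] /(ZP Q0 j' AQ0)[Bj' _ _]; apply: aS.
  - move=> Q j AQ Zj; have [Bj nij _] := ZP Q j AQ Zj.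
    by apply: (dKS i) => //; case: (AP Q AQ).
  - by move=> Q j AQ Zj; case: (ZP Q j AQ Zj).
(* The sets [z i] give a digraph of out-degree at most [t]; for [i] in an independent [J], the paths
   with value [z i] avoid all other stems of [J]. *)
have [||J [sJ cJ indJ]] := @sparse_independent _ (fun i j => j \in z i) t k B.
- move=> i Bi; have [_] := zP i Bi; apply: leq_trans; apply: subset_leq_card.
  by apply/subsetP => j; rewrite inE => /and3P[].
- by rewrite cB.
have BJ i : i \in J -> i \in B by apply: (subsetP sJ).
have [| | |q [qK qE]] := @independent_transversal _ _ set0 (@touch G) t J
    (fun i => [set Q in K i | h i Q == z i]).
- by move=> X Y; apply: touch_sym.
- move=> i /BJ Bi; have [lez _] := zP i Bi; rewrite cJ.
  by apply: leq_trans (ltnW lez); apply: leq_addr.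
- move=> i j A A' /BJ Bi /BJ Bj nij sA sA' cA cA'.
  have AP Q : Q \in A -> Q \in K i by move=> /(subsetP sA); rewrite inE => /andP[].
  have AP' Q : Q \in A' -> Q \in K j by move=> /(subsetP sA'); rewrite inE => /andP[].
  apply: (tidy_no_biclique tdy t_gt0 cA cA' (P := id) (Q := id)).
  + by move=> Q /AP; apply: (cK i Bi).
  + by move=> Q /AP'; apply: (cK j Bj).
  + by move=> Q Q' /AP KQ /AP KQ'; apply: (aK i Bi).
  + by move=> Q Q' /AP' KQ /AP' KQ'; apply: (aK j Bj).
  + move=> Q Q' /AP KQ /AP' KQ'; apply: disjointW (dV i j Bi Bj nij).
      exact: (sK i).
    exact: (sK j).
have qP i : i \in J -> q i \in K i /\ h i (q i) = z i.
  by move=> /qK; rewrite inE => /andP[? /eqP].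
exists J, q; split=> //; first by move=> i /qP[].
have aSq i j : i \in J -> j \in J -> i != j -> apart (q i) (S j).
  move=> Ji Jj nij; have [Kq hq] := qP i Ji.
  rewrite /apart (dKS i) ?BJ //=; have := indJ i j Ji Jj nij.
  by rewrite -hq inE BJ // eq_sym nij.
move=> i j Ji Jj nij; rewrite apartUl !apartUr aS ?BJ //= aSq // apart_sym.
rewrite aSq 1?eq_sym //= /apart qE // andbT.
have [[Kqi _] [Kqj _]] := (qP i Ji, qP j Jj).
apply: disjointW (dV i j (BJ i Ji) (BJ j Jj) nij).
  exact: sK (BJ i Ji) _ Kqi.
exact: sK (BJ j Jj) _ Kqj.
Qed.

(** * Growing new stems along the links *)

Lemma last_below (F : nat -> nat) m n : F 0 < m ->
  exists k, [/\ k <= n, F k < m & k = n \/ k < n /\ m <= F k.+1].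
Proof.
move=> F0; elim: n => [|n [k [lek Fk [kn|[ltk Fk1]]]]].
- by exists 0; split=> //; left.
- have [leF|ltF] := leqP m (F n.+1).
    by exists n; split; rewrite // -?kn //; right; rewrite kn.
  by exists n.+1; split=> //; left.
- by exists k; split=> //; [apply: leqW | right; split=> //; apply: leqW].
Qed.

(** Touching is measured against the tails [p j] only, because the heads [x j] will be adjacent to
    the original stem and must stay out of the new links. Adjacencies between heads are excluded by
    a separate Ramsey choice. *)
Lemma stems_exist (G : sgraph) t k m n (T : finType) (I : {set T})
    (x : T -> G) (p : T -> seq G) :
  tidy t G -> 0 < m ->
  {in I &, forall i j, i != j ->
     [disjoint [set z in x i :: p i] & [set z in x j :: p j]]} ->
  (forall J : {set T}, J \subset I -> #|J| = k ->
     ~ {in J &, forall i j, i != j ->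
          apart [set z in x i :: p i] [set z in x j :: p j]}) ->
  (2 * m + 1) * ramsey_size (k + ramsey_size (2 * n) t) t <= #|I| ->
  exists (J : {set T}) (l : T -> nat),
    let S i := [set z in x i :: take (l i) (p i)] in
    [/\ J \subset I, #|J| = n,
        {in J &, forall i j, i != j -> apart (S i) (S j)}
      & {in J, forall i, m <= #|[set j in I | (j != i) && touch (S i) [set z in p j]]|}].
Proof.
move=> tdy m_gt0 dI noI leI.
pose w i := x i :: p i.
pose D i l := [set j in I | (j != i) && touch [set z in take l (w i)] [set z in p j]].
have /fin_all_exists[l lP] i : exists l, [/\ l <= size (w i), #|D i l| < m
    & l = size (w i) \/ l < size (w i) /\ m <= #|D i l.+1|].
  apply: (@last_below (fun l => #|D i l|) m (size (w i))).
  rewrite (_ : D i 0 = set0) ?cards0 //.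
  apply/setP => j; rewrite !inE take0; case: touchP => [[u [v []]]|]; rewrite ?inE //.
  by rewrite !andbF.
pose S0 i := [set z in take (l i) (w i)].
have S0w i z : z \in S0 i -> z \in w i by rewrite inE; apply: mem_take.
have [||J1 [sJ1 cJ1 indJ1]] := @sparse_independent _
  (fun i j => touch (S0 i) [set z in p j]) m
  (ramsey_size (k + ramsey_size (2 * n) t) t) I.
- by move=> i _; have [_ /ltnW] := lP i.
- exact: leI.
have injw i j z : i \in I -> j \in I -> z \in w i -> z \in w j -> i = j.
  move=> Ii Ij wi wj; apply/eqP; apply: contraT => nij.
  by have /pred0P/(_ z) := dI i j Ii Ij nij; move: wi wj; rewrite /= !inE => -> ->.
have [||J2 [sJ2 cJ2 stJ2]] := @tidy_stable t G T J1 x (k + ramsey_size (2 * n) t) tdy.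
- move=> i j /(subsetP sJ1) Ii /(subsetP sJ1) Ij eqx.
  by apply: (injw i j (x i)) => //; [|rewrite eqx]; apply: mem_head.
- by rewrite cJ1.
have sJ2I := subset_trans sJ2 sJ1.
(* Edges into the tail [p j] are excluded by the choice of [J1], edges between heads by [J2]. An
   edge from the tail [p i] to the head [x j] makes the prefix of [j] touch [p i], provided that
   this prefix contains [x j]. *)
have nadj i j u v : i \in J2 -> j \in J2 -> i != j -> x j \in S0 j ->
    u \in S0 i -> v \in w j -> ~~ (u -- v).
  move=> Ji Jj nij Sxj Su wv; apply/negP => uv.
  have indJ a b : a \in J2 -> b \in J2 -> a != b -> ~~ touch (S0 a) [set z in p b].
    by move=> /(subsetP sJ2) Ja /(subsetP sJ2) Jb; apply: indJ1.
  move: wv; rewrite inE => /predU1P[vx|pv]; last first.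
    by case/touchP: (indJ i j Ji Jj nij); exists u, v; rewrite inE.
  have:= S0w i u Su; rewrite inE => /predU1P[ux|pu].
    by have := stJ2 i j Ji Jj nij; rewrite -ux -vx uv.
  have nji : j != i by rewrite eq_sym.
  case/touchP: (indJ j i Jj Ji nji).
  by exists v, u; split; [rewrite vx | rewrite inE | rewrite edge_sym].
(* Words whose growth never stopped: they are pairwise apart, so [noI] allows fewer than [k] of
   them. *)
pose J3 := [set i in J2 | l i == size (w i)].
have ltJ3 : #|J3| < k.
  rewrite ltnNge; apply/negP => /subset_of_card[J sJ cJ].
  have sJJ2 i : i \in J -> i \in J2 /\ S0 i = [set z in w i].
    move=> /(subsetP sJ); rewrite inE => /andP[-> /eqP li]; split=> //.
    by rewrite /S0 li take_size.
  apply: (noI J _ cJ).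
    by apply/subsetP => i /sJJ2[/(subsetP sJ2I)].
  move=> i j /sJJ2[Ji Si] /sJJ2[Jj Sj] nij.
  rewrite /apart dI ?(subsetP sJ2I) //=; apply/touchP => -[u [v [wu wv]]].
  apply/negP; rewrite -Si in wu; apply: (nadj i j) => //; last by rewrite inE in wv.
  by rewrite Sj inE mem_head.
pose s i := nth (x i) (w i) (l i).
(* One vertex more than [S0 i], so that [m] tails are touched. As [l i] counts vertices of [w i],
   this is the vertex set of [x i :: take (l i) (p i)]. *)
pose S i := [set z in take (l i).+1 (w i)].
have J4P i : i \in J2 :\: J3 -> [/\ i \in J2, l i < size (w i) & m <= #|D i (l i).+1|].
  case/setDP=> Ji; rewrite inE Ji /= => nl.
  by have [_ _ [/eqP|[]]] := lP i; first rewrite (negPf nl).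
have [||J5 [sJ5 cJ5 stJ5]] := @tidy_stable t G T (J2 :\: J3) s (2 * n) tdy.
- move=> i j /J4P[Ji ltli _] /J4P[Jj ltlj _] eqs.
  apply: (injw i j (s i)); rewrite ?(subsetP sJ2I) //; first exact: mem_nth.
  by rewrite eqs mem_nth.
- rewrite cardsD cJ2 leq_subRL; last first.
    by rewrite -cJ2; apply: subset_leq_card (subsetIl _ _).
  rewrite leq_add2r; apply: leq_trans (ltnW ltJ3).
  exact: subset_leq_card (subsetIr _ _).
(* If [l i] is zero, [S0 i] misses the head and [nadj] fails, so half of [J5] is kept on which [l i]
   is always or never zero. In the first case the stems are the single vertices [s i], which are
   stable; in the second, [nadj] covers every pair except two added vertices. *)
have [J [b [sJ cJ bJ]]] : exists (J : {set T}) (b : bool),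
    [/\ J \subset J5, #|J| = n & {in J, forall i, (l i == 0) = b}].
  pose Z b := [set i in J5 | (l i == 0) == b].
  have ZP b : n <= #|Z b| -> exists (J : {set T}) (b : bool),
      [/\ J \subset J5, #|J| = n & {in J, forall i, (l i == 0) = b}].
    case/subset_of_card=> J sJ cJ; exists J, b; split=> //.
      by apply: subset_trans sJ _; apply/subsetP => i; rewrite inE => /andP[].
    by move=> i /(subsetP sJ); rewrite inE => /andP[_ /eqP].
  have [|ltZ] := leqP n #|Z true|; first exact: ZP.
  apply: (ZP false); rewrite -(leq_add2l n) addnn -mul2n -cJ5.
  have sZ : J5 \subset Z true :|: Z false.
    by apply/subsetP => i; rewrite !inE => ->; case: (l i == 0).
  apply: leq_trans (subset_leq_card sZ) _.
  by apply: leq_trans (leq_card_setU _ _).1 _; rewrite leq_add2r ltnW.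
have JP i : i \in J -> [/\ i \in J2, l i < size (w i) & m <= #|D i (l i).+1|].
  by move=> /(subsetP sJ)/(subsetP sJ5)/J4P.
have SE i z : i \in J -> z \in S i -> z = s i \/ z \in S0 i.
  case/JP=> _ lti _; rewrite in_set (take_nth (x i)) // mem_rcons in_cons.
  by case/predU1P; [left | right; rewrite in_set].
have Sw i z : z \in S i -> z \in w i by rewrite inE; apply: mem_take.
exists J, l; split=> //.
- apply: subset_trans sJ (subset_trans sJ5 _).
  by apply/subsetP => i /J4P[/(subsetP sJ2I)].
- move=> i j Ji Jj nij; rewrite -/(S i) -/(S j).
  have [Ji2 lti _] := JP i Ji; have [Jj2 ltj _] := JP j Jj.
  apply/andP; split.
    apply: disjointW (dI i j _ _ nij); rewrite ?(subsetP sJ2I) //.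
      by apply/subsetP => z /Sw; rewrite inE.
    by apply/subsetP => z /Sw; rewrite inE.
  apply/touchP => -[u [v [Su Sv]]]; apply/negP.
  have xS a : a \in J -> l a != 0 -> x a \in S0 a.
    by move=> Ja; rewrite inE; case: (l a) => // la _; rewrite mem_head.
  have S00 a z : l a = 0 -> z \in S0 a -> False.
    by rewrite inE => ->; rewrite take0.
  have stS : ~~ (s i -- s j) by apply: stJ5 => //; apply: (subsetP sJ).
  have := bJ i Ji; case: (eqVneq (l i) 0) => [li0|li0] bE.
    have lj0 : l j = 0 by apply/eqP; rewrite bJ // -bE.
    have [->|/(S00 i _ li0)//] := SE i u Ji Su.
    by have [->|/(S00 j _ lj0)//] := SE j v Jj Sv.
  have lj0 : l j != 0 by rewrite bJ // -bE.
  have [us|Su0] := SE i u Ji Su; last first.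
    by apply: (nadj i j) => //; [apply: xS | apply: Sw].
  have [vs|Sv0] := SE j v Jj Sv; first by rewrite us vs.
  rewrite edge_sym; apply: (nadj j i); rewrite 1?eq_sym //; first exact: xS.
  exact: Sw.
- by move=> i /JP[].
Qed.

(** * Branching *)

(** By minimality of the link: a later vertex in the neighborhood of [A] would start a suffix
    containing a joining path that misses [x]. *)
Lemma link_word (G : sgraph) (A Y P : {set G}) :
  XY_path ([set: G] :\: A) (neighborhood [set: G] A) Y P ->
  exists (x : G) (p : seq G),
    [/\ P = [set z in x :: p], induced_path_seq x p,
        x \in neighborhood [set: G] A, last x p \in Y
      & {in p, forall z, z \notin A :|: neighborhood [set: G] A}].
Proof.
case=> -[sP [x [y [[p [ip lp defP]] Nx Yy]]]] minP.
exists x, p; split; rewrite ?lp // => z pz; rewrite inE negb_or; apply/andP; split.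
  have: z \in P by rewrite defP !inE pz orbT.
  by move=> /(subsetP sP); rewrite !inE andbT.
apply/negP => Nz; have pth := induced_path_path ip; have [/andP[nxp _] _] := ip.
case/splitPr def_p: p / pz => [p1 p2].
have sC : [set u in z :: p2] \subset P.
  apply/subsetP => u; rewrite defP def_p !(inE, mem_cat) => ->.
  by rewrite !orbT.
have cC : conn [set u in z :: p2].
  by apply: conn_seq; move: pth; rewrite def_p cat_path /= => /and3P[].
have [||Q sQ [jQ _]] := XY_path_exists cC (subset_trans sC sP)
    (X := neighborhood [set: G] A) (Y := Y).
- by exists z => //; rewrite inE mem_head.
- exists y => //; rewrite -lp def_p last_cat /= inE; exact: mem_last.
have := minP Q jQ (subset_trans sQ sC) => QP; move: sQ; rewrite QP => /subsetP/(_ x).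
rewrite defP inE mem_head => /(_ isT); rewrite inE => xp2.
by move: nxp; rewrite def_p mem_cat xp2 orbT.
Qed.

Lemma induced_path_seq_take (G : sgraph) (x : G) p l :
  induced_path_seq x p -> induced_path_seq x (take l p).
Proof.
case=> up adj; rewrite /induced_path_seq -[x :: take l p]/(take l.+1 (x :: p)).
split; first exact: take_uniq.
move=> i j; rewrite size_take_min !leq_min => /andP[lti lti'] /andP[ltj ltj'].
by rewrite !nth_take //; apply: adj.
Qed.

(** One above the threshold in [witness_transversal] for [(2 * t + 1) * k] failing seedlings. *)
Definition rigidity_bound t k :=
  (2 ^ ((2 * t + 1) * k) * (transversal_size t k + t)).+1.

(** [n] stems are built, of which fewer than [(2 * t + 1) * k] fail to be rigid; each touches
    [n * lambda.+1] tails. *)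
Definition seedling_bound t delta lambda k :=
  let n := delta + (2 * t + 1) * k in
  (2 * (n * lambda.+1) + 1) * ramsey_size (k + ramsey_size (2 * n) t) t.

Lemma link_words (G : sgraph) (A Y : {set G}) (I : {set {set G}}) :
  let NA := neighborhood [set: G] A in
  0 < #|I| -> {in I, forall i, XY_path ([set: G] :\: A) NA Y i} ->
  exists (x : {set G} -> G) (p : {set G} -> seq G), {in I, forall i,
    [/\ i = [set z in x i :: p i], induced_path_seq (x i) (p i), x i \in NA,
        last (x i) (p i) \in Y & {in p i, forall z, z \notin A :|: NA}]}.
Proof.
(* [x0] is the default head off [I]. *)
move=> NA /card_gt0P[i0 Ii0] pI; have [x0 _] := link_word (pI i0 Ii0).
have /fin_all_exists[w wP] i : exists w : G * seq G, i \in I ->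
   [/\ i = [set z in w.1 :: w.2], induced_path_seq w.1 w.2,
     w.1 \in NA, last w.1 w.2 \in Y & {in w.2, forall z, z \notin A :|: NA}].
  case: (boolP (i \in I)) => [Ii|_]; last by exists (x0, [::]).
  by have [x [p xpP]] := link_word (pI i Ii); exists (x, p).
by exists (fun i => (w i).1), (fun i => (w i).2).
Qed.

Lemma rigid_branching (G : sgraph) t delta lambda k (s : triple G) :
  tidy t G -> 0 < t -> 0 < delta ->
  seedling [set: G] (seedling_bound t delta lambda k) s ->
  rigid [set: G] k s ->
  exists S : 'I_delta -> triple G,
  [/\ forall i, seedling (~: stem s) lambda (S i),
      forall i j, i != j -> disjoint_seedlings (S i) (S j),
      forall i j, i != j -> anticomplete (stem (S i)) (stem (S j))
    & forall i, [/\ ~ anticomplete (stem s) (stem (S i)),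
                    anticomplete (stem s) (cover (links (S i)))
                  & rigid [set: G] (rigidity_bound t k) (S i)]].
Proof.
move=> tdy t_gt0 delta_gt0 [_ sYA cI dI pI] s_rigid.
have I_gt0 : 0 < #|links s| by rewrite cI muln_gt0 addn1 ramsey_size_gt0.
have [x [p xpP]] := link_words I_gt0 pI.
set A := stem s in sYA pI xpP *; set Y := target s in sYA pI xpP *.
set I := links s in cI dI pI I_gt0 xpP *; set NA := neighborhood _ A in pI xpP *.
pose n := delta + (2 * t + 1) * k.
have n_gt0 : 0 < n by apply: ltn_addr.
have dW : {in I &, forall i j, i != j ->
    [disjoint [set z in x i :: p i] & [set z in x j :: p j]]}.
  move=> i j Ii Ij nij; have [<- _ _ _ _] := xpP i Ii; have [<- _ _ _ _] := xpP j Ij.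
  exact: dI.
have sWI : {in I, forall i, [set z in x i :: p i] \subset cover I}.
  by move=> i Ii; have [<- _ _ _ _] := xpP i Ii; apply: bigcup_sup Ii.
have [||||J [l]] := @stems_exist G t k (n * lambda.+1) n _ I x p tdy.
- by rewrite muln_gt0 n_gt0.
- exact: dW.
- move=> J /subsetP sJ cJ; apply: (rigid_no_family s_rigid cJ) => i /sJ Ji.
  + by have [_ /induced_path_path/conn_seq] := xpP i Ji.
  + exact: sWI.
  + by have [_ _ Nx _ _] := xpP i Ji; exists (x i); rewrite // inE mem_head.
  + by have [_ _ _ Yx _] := xpP i Ji; exists (last (x i) (p i)); rewrite // inE mem_last.
- by rewrite cI.
pose S i := [set z in x i :: take (l i) (p i)].
case=> /subsetP sJ cJ aS tS.
(* Discarding [J] costs at most [n] of the [n * lambda.+1] touched tails and keeps link words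
   distinct from stem words; [n * lambda] remain for the private choices. *)
have [||c [sc cc dc]] := @disjoint_representatives _ _
   (fun i => [set j in I | (j != i) && touch (S i) [set z in p j]] :\: J) lambda n J.
- by rewrite cJ.
- move=> i Ji; rewrite cardsD leq_subRL; last exact: subset_leq_card (subsetIl _ _).
  apply: leq_trans (tS i Ji); rewrite mulnS leq_add2r -cJ.
  exact: subset_leq_card (subsetIr _ _).
have cP i j : i \in J -> j \in c i ->
    [/\ j \in I, j != i, touch (S i) [set z in p j] & j \notin J].
  by move=> Ji /(subsetP (sc i Ji)); rewrite !inE => /andP[-> /and3P[-> -> ->]].
have SW i : S i \subset [set z in x i :: p i].
  apply/subsetP => z; rewrite !inE => /predU1P[->|/mem_take->]; rewrite ?eqxx ?orbT //.
have pW i : [set z in p i] \subset [set z in x i :: p i].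
  by apply/subsetP => z; rewrite !inE => ->; rewrite orbT.
have WA i z : i \in I -> z \in [set z in x i :: p i] -> z \notin A.
  move=> Ii; have [_ _ Nx _ pN] := xpP i Ii; rewrite inE => /predU1P[->|/pN].
    by move: Nx; rewrite !inE => /andP[/andP[]].
  by rewrite inE negb_or => /andP[].
(* The link [P (i, j)] is carved out of the tail [p j], which is connected, misses [A] and [S i],
   touches [S i] and ends in [Y]. *)
have /fin_all_exists[P PP] ij : exists P : {set G},
    ij.1 \in J -> ij.2 \in c ij.1 ->
    P \subset [set z in p ij.2] /\
    XY_path (~: A :\: S ij.1) (neighborhood (~: A) (S ij.1)) (Y :\: S ij.1) P.
  case: ij => i j /=.
  case: (boolP ((i \in J) && (j \in c i))) => [/andP[Ji cj]|nij]; last first.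
    by exists set0 => Ji cj; rewrite Ji cj in nij.
  have [Ij nji tij _] := cP i j Ji cj.
  have [_ ip _ lY _] := xpP j Ij.
  have pS z : z \in p j -> z \in ~: A :\: S i.
    move=> pz; have wz : z \in [set z in x j :: p j] by rewrite !inE pz orbT.
    rewrite inE [z \in ~: A]inE (WA j) // andbT; apply/negP => /(subsetP (SW i)) wz'.
    by have /pred0P/(_ z) := dW j i Ij (sJ i Ji) nji; rewrite /= wz wz'.
  case def_p: (p j) => [|a q].
    by case/touchP: tij => u [v [_]]; rewrite def_p inE.
  have [|||| Q sQ jQ] := @XY_path_exists G [set z in p j] (~: A :\: S i)
     (neighborhood (~: A) (S i)) (Y :\: S i).
  - rewrite def_p; apply: conn_seq; move: (induced_path_path ip).
    by rewrite def_p /= => /andP[].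
  - by apply/subsetP => z; rewrite inE => /pS.
  - case/touchP: tij => u [v [Su pv uv]]; exists v => //.
    move: pv; rewrite inE => /pS; rewrite inE [v \in neighborhood _ _]inE => /andP[nS nA].
    by rewrite inE nS nA /=; apply/exists_inP; exists u.
  - exists (last (x j) (p j)); first by rewrite inE def_p /= mem_last.
    rewrite inE lY andbT.
    have /pS : last (x j) (p j) \in p j by rewrite def_p /= mem_last.
    by rewrite inE => /andP[].
  by exists Q; rewrite -def_p.
pose tr i := Triple (S i) [set P (i, j) | j in c i] (Y :\: S i).
(* All words used by the seedling of [i]. These territories are disjoint because the link indices
   are private and lie outside [J]. *)
pose V i := \bigcup_(j in i |: c i) [set z in x j :: p j].
have UI i j : i \in J -> j \in i |: c i -> j \in I.
  by move=> Ji /setU1P[->|/(cP i j Ji)[]] //; apply: sJ.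
have dV : {in J &, forall i j, i != j -> [disjoint V i & V j]}.
  move=> i j Ji Jj nij; apply/pred0P => z; apply/negP => /= /andP[].
  case/bigcupP=> a Ua wa /bigcupP[b Ub wb].
  have eqab : a = b.
    apply/eqP; apply: contraT => nab.
    by have /pred0P/(_ z) := dW a b (UI i a Ji Ua) (UI j b Jj Ub) nab; rewrite /= wa wb.
  subst b; move: Ua Ub => /setU1P[->|ca] /setU1P[aj|caj].
  - by rewrite aj eqxx in nij.
  - by have [_ _ _] := cP j i Jj caj; rewrite Ji.
  - by have [_ _ _] := cP i a Ji ca; rewrite aj Jj.
  - by have /pred0P/(_ a) := dc i j Ji Jj nij; rewrite /= ca caj.
have sSV i : S i \subset V i.
  by apply: subset_trans (SW i) (bigcup_sup _ _); rewrite setU11.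
have coverP i z : i \in J -> z \in cover (links (tr i)) ->
    exists2 j, j \in c i & z \in p j.
  move=> Ji /bigcupP[_ /imsetP[j cj ->] Pz]; exists j => //.
  by have [/subsetP/(_ z Pz)] := PP (i, j) Ji cj; rewrite inE.
have scV i : i \in J -> cover (links (tr i)) \subset V i.
  move=> Ji; apply/subsetP => z /(coverP i z Ji)[j cj pz].
  by apply/bigcupP; exists j; rewrite ?(setU1r _ cj) // !inE pz orbT.
have VI i : i \in J -> V i \subset cover I.
  by move=> Ji; apply/bigcupsP => j /(UI i j Ji)/sWI.
have dP i j j' : i \in J -> j \in c i -> j' \in c i -> j != j' ->
    [disjoint P (i, j) & P (i, j')].
  move=> Ji cj cj' njj'.
  have [Ij _ _ _] := cP i j Ji cj; have [Ij' _ _ _] := cP i j' Ji cj'.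
  have [sP _] := PP (i, j) Ji cj; have [sP' _] := PP (i, j') Ji cj'.
  apply: disjointW (dW j j' Ij Ij' njj').
    exact: subset_trans sP (pW j).
  exact: subset_trans sP' (pW j').
have seed_tr i : i \in J -> seedling (~: A) lambda (tr i).
  move=> Ji; have [_ ip _ _ _] := xpP i (sJ i Ji); split=> /=.
  - split.
      apply/subsetP => z /(subsetP (SW i)) wz; rewrite inE.
      exact: WA (sJ i Ji) wz.
    exists (x i), (last (x i) (take (l i) (p i))), (take (l i) (p i)); split=> //.
    exact: induced_path_seq_take.
  - apply: setSD; apply: subset_trans sYA _.
    by apply/subsetP => z; rewrite !inE andbT.
  - rewrite card_in_imset ?cc // => j j' cj cj' eqP; apply: contraTeq (cj) => njj'.
    have /pred0P := dP i j j' Ji cj cj' njj'.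
    have [_ [/joins_conn[_ [z Pz _] _] _]] := PP (i, j) Ji cj.
    by move/(_ z); rewrite /= -eqP Pz.
  - move=> _ _ /imsetP[j cj ->] /imsetP[j' cj' ->] neq; apply: dP => //.
    by apply: contraNneq neq => ->.
  - by move=> _ /imsetP[j cj ->]; have [] := PP (i, j) Ji cj.
(* Rigidity is made boolean classically, so that the rigid seedlings can be counted. *)
have /fin_all_exists[b bP] i : exists b : bool,
    b <-> rigid [set: G] (rigidity_bound t k) (tr i).
  have [r|r] := classic (rigid [set: G] (rigidity_bound t k) (tr i)).
    by exists true.
  by exists false.
pose good := [set i in J | b i].
have good_ge : delta <= #|good|.
  have cJE : #|good| + #|[set i in J | ~~ b i]| = n.
    rewrite -cJ -(cardsID [set i | b i] J); congr (_ + _); apply: eq_card => i.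
      by rewrite !inE.
    by rewrite !inE andbC.
  rewrite leqNgt; apply/negP => lt_good.
  have /subset_of_card[B sB cB] : (2 * t + 1) * k <= #|[set i in J | ~~ b i]|.
    rewrite -(leq_add2l #|good|) cJE leq_add2r; exact: ltnW.
  have BJ i : i \in B -> i \in J by move=> /(subsetP sB); rewrite inE => /andP[].
  have /fin_all_exists[K KP] i : exists K : {set {set G}}, i \in B ->
     [/\ #|K| = rigidity_bound t k,
        forall Q, Q \in K -> XY_path [set: G] (neighborhood [set: G] (S i)) (Y :\: S i) Q,
        forall Q Q', Q \in K -> Q' \in K -> Q != Q' -> anticomplete Q Q'
      & cover K \subset cover (links (tr i))].
    case: (boolP (i \in B)) => [Bi|_]; last by exists set0.
    have nr : ~ rigid [set: G] (rigidity_bound t k) (tr i).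
      by move/bP => bi; have := subsetP sB i Bi; rewrite inE bi andbF.
    by have [K KP] := NNPP _ nr; exists K.
  have sK : {in B, forall i,
      {in K i, forall Q : {set G}, Q \subset cover (links (tr i))}}.
    move=> i Bi Q KQ; have [_ _ _] := KP i Bi; apply: subset_trans.
    exact: bigcup_sup KQ.
  have cS : {in B, forall i, conn (S i)}.
    move=> i Bi; have [_ ip _ _ _] := xpP i (sJ i (BJ i Bi)).
    exact: conn_seq (induced_path_path (induced_path_seq_take (l i) ip)).
  have [||||||||C [q [sC cC qK aC]]] := @witness_transversal G t k _ B S V K tdy t_gt0 cB.
  - by move=> i Bi; have [-> _ _ _] := KP i Bi; rewrite cB.
  - exact: cS.
  - by move=> i Bi Q KQ; have [_ /(_ Q KQ)[/joins_conn[]]] := KP i Bi.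
  - move=> i Bi Q Q' KQ KQ' nQ; apply/anticompleteP.
    by have [_ _ aK _] := KP i Bi; apply: aK.
  - by move=> i j /BJ Ji /BJ Jj; apply: aS.
  - by move=> i _; apply: sSV.
  - by move=> i Bi Q KQ; apply: subset_trans (sK i Bi Q KQ) (scV i (BJ i Bi)).
  - by move=> i j /BJ Ji /BJ Jj; apply: dV.
  have CB i : i \in C -> i \in B by apply: (subsetP sC).
  (* Each union is connected because [q i] starts next to [S i]; it contains the head [x i], reaches
     [Y] through [q i], and stays inside the original links. *)
  apply: (rigid_no_family s_rigid cC (C := fun i => S i :|: q i)) => //.
  - move=> i Ci; have Bi := CB i Ci; have Kq := qK i Ci.
    have [_ /(_ _ Kq)[/joins_conn[cq [v qv Nv] _] _] _ _] := KP i Bi.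
    apply: connU => //; first exact: cS.
    move: Nv; rewrite !inE => /andP[_ /exists_inP[u Su uv]].
    by apply/touchP; exists u, v.
  - move=> i Ci; have Bi := CB i Ci; apply: subset_trans (VI i (BJ i Bi)).
    rewrite subUset sSV /=.
    exact: subset_trans (sK i Bi _ (qK i Ci)) (scV i (BJ i Bi)).
  - move=> i Ci; exists (x i); first by rewrite !inE eqxx.
    by have [_ _ ] := xpP i (sJ i (BJ i (CB i Ci))).
  - move=> i Ci; have Bi := CB i Ci; have Kq := qK i Ci.
    have [_ /(_ _ Kq)[/joins_conn[_ _ [y qy Yy]] _] _ _] := KP i Bi.
    by exists y; [rewrite inE qy orbT | move: Yy; rewrite inE => /andP[]].
have [J' sJ' cJ'] := subset_of_card good_ge.
pose a (i : 'I_delta) := enum_val (cast_ord (esym cJ') i).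
have aP i : a i \in J /\ b (a i).
  by have /(subsetP sJ') := enum_valP (cast_ord (esym cJ') i); rewrite inE => /andP.
have inja i j : i != j -> a i != a j.
  by apply: contraNneq => /enum_val_inj /cast_ord_inj ->.
exists (fun i => tr (a i)); split.
- by move=> i; apply: seed_tr; case: (aP i).
- move=> i j nij; have [Ji _] := aP i; have [Jj _] := aP j.
  have sV h : h \in J -> Defs.support (tr h) \subset V h.
    by move=> Jh; rewrite subUset sSV scV.
  exact: disjointW (sV _ Ji) (sV _ Jj) (dV _ _ Ji Jj (inja i j nij)).
- move=> i j nij; have [Ji _] := aP i; have [Jj _] := aP j.
  by apply/anticompleteP; apply: aS => //; apply: inja.
- move=> i; have [Ji bi] := aP i; split; last exact/bP.
  (* The head of the new stem has a neighbour in [A]. *)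
  + case=> _ nadj; have [_ _ Nx _ _] := xpP _ (sJ _ Ji).
    move: Nx; rewrite !inE => /andP[_ /exists_inP[u Au ux]].
    by have := nadj u (x (a i)) Au; rewrite ux !inE eqxx => /(_ isT).
  (* The new links run inside tails, which avoid [A] and its neighborhood. *)
  + have covN z : z \in cover (links (tr (a i))) -> z \notin A :|: NA.
      case/(coverP _ z Ji)=> j cj pz; have [Ij _ _ _] := cP _ j Ji cj.
      by have [_ _ _ _ /(_ z pz)] := xpP j Ij.
    split.
      apply/pred0P => z; apply/negP => /= /andP[Az /covN].
      by rewrite inE Az.
    move=> u z Au /covN; rewrite !inE andbT negb_or => /andP[-> /=].
    by apply: contra => uz; apply/exists_inP; exists u.
Qed.

Theorem theorem3p2 :
  exists (f : nat -> nat -> nat -> nat -> nat) (g : nat -> nat -> nat),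
  forall t delta lambda kappa : nat,
    0 < t -> 0 < delta -> 0 < lambda -> 0 < kappa ->
    [/\ 0 < f t delta lambda kappa,
        0 < g t kappa
      & forall (G : sgraph) (s : triple G),
          tidy t G ->
          seedling [set: G] (f t delta lambda kappa) s ->
          rigid [set: G] kappa s ->
          exists S : 'I_delta -> triple G,
            [/\ forall i, seedling (~: stem s) lambda (S i),
                forall i j, i != j -> disjoint_seedlings (S i) (S j),
                forall i j, i != j -> anticomplete (stem (S i)) (stem (S j))
              & forall i,
                  [/\ ~ anticomplete (stem s) (stem (S i)),
                      anticomplete (stem s) (cover (links (S i)))
                    & rigid [set: G] (g t kappa) (S i)]]].
Proof.
exists seedling_bound, rigidity_bound => t delta lambda k t_gt0 delta_gt0 _ _.
split=> //; first by rewrite muln_gt0 addn1 ramsey_size_gt0.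
by move=> G s tdy sd rg; apply: rigid_branching tdy t_gt0 delta_gt0 sd rg.
Qed.
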